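(* Suppose $\mu:=\mathbb{E}[\xi]\in(0,\infty)$. The following assertions are equivalent: (S1) $\lim_{t\to\infty}t^{-1}\tau(t)=\mu^{-1}$ almost surely; (S2) $\lim_{n\to\infty}n^{-1}\max_{1\le k\le n}T_k=\mu$ almost surely; (S3) $\mathbb{E}[\eta^+]<\infty$.
   Context: Let $(\xi_1,\eta_1),(\xi_2,\eta_2),\ldots$ be independent copies of an $\mathbb{R}^2$-valued random vector $(\xi,\eta)$ with arbitrarily dependent components. Put $S_0:=0$, $S_n:=\xi_1+\ldots+\xi_n$ for $n\in\mathbb{N}=\{1,2,\ldots\}$, and $T_n:=S_{n-1}+\eta_n$ for $n\in\mathbb{N}$ (the globally perturbed random walk). For $t\in\mathbb{R}$ define the first passage time $\tau(t):=\inf\{n\ge 1: T_n>t\}$, with the convention $\inf\varnothing=\infty$. Here $x^+=\max(x,0)$ for $x\in\mathbb{R}$. *)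

(* Defs.v *)
From HB Require Import structures.
From mathcomp Require Import all_boot all_order all_algebra finmap.
From mathcomp Require Import all_classical all_reals all_analysis.

Set Implicit Arguments.
Unset Strict Implicit.
Unset Printing Implicit Defensive.

Import Order.TTheory GRing.Theory Num.Theory.
Import numFieldNormedType.Exports.

Local Open Scope classical_set_scope.
Local Open Scope ring_scope.

Definition mutually_independent d d' (Omega : measurableType d)
    (T : measurableType d') (R : realType) (P : probability Omega R)
    (I : choiceType) (X : I -> {RV P >-> T}) : Prop :=
  forall (J : {fset I}) (A : I -> set T),
    (forall i, i \in J -> measurable (A i)) ->
    P (\bigcap_(i in [set` J]) X i @^-1` A i) =
      (\prod_(i <- J) P (X i @^-1` A i))%E.

(* Equality of laws is tested on measurable sets only: [distribution P X] is a
   function on all subsets of [T], with no meaning on nonmeasurable ones. *)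
Definition same_law d d' (Omega : measurableType d) (T : measurableType d')
    (R : realType) (P : probability Omega R) (X Y : {RV P >-> T}) : Prop :=
  forall A : set T, measurable A -> distribution P X A = distribution P Y A.

Definition independent_copies d d' (Omega : measurableType d)
    (T : measurableType d') (R : realType) (P : probability Omega R)
    (X : nat -> {RV P >-> T}) (Y : {RV P >-> T}) : Prop :=
  mutually_independent X /\ forall n, same_law (X n) Y.

(* [V n w] is the pair (xi_{n+1}, eta_{n+1}) at the sample point [w]: the
   steps, indexed from 1 in the mathematical notation, are stored from 0. *)
Definition random_walk (Omega : Type) (R : realType)
    (V : nat -> Omega -> R * R) (n : nat) (w : Omega) : R :=
  \sum_(i < n) (V i w).1.

(* T_n = S_{n-1} + eta_n; meaningful for n >= 1 only. *)
Definition perturbed_walk (Omega : Type) (R : realType)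
    (V : nat -> Omega -> R * R) (n : nat) (w : Omega) : R :=
  random_walk V n.-1 w + (V n.-1 w).2.

Definition first_passage (Omega : Type) (R : realType)
    (V : nat -> Omega -> R * R) (t : R) (w : Omega) : \bar R :=
  ereal_inf [set n%:R%:E |
             n in [set n : nat | (1 <= n)%N /\ perturbed_walk V n w > t]].

(* The maximum of T_1, ..., T_n for n >= 1 (the initial value T_1 of the
   iterated max is one of the terms). *)
Definition perturbed_walk_max (Omega : Type) (R : realType)
    (V : nat -> Omega -> R * R) (n : nat) (w : Omega) : R :=
  \big[Num.max/perturbed_walk V 1 w]_(1 <= k < n.+1) perturbed_walk V k w.

(* Main.v *)
Require Import Defs.
From HB Require Import structures.
From mathcomp Require Import all_boot all_order all_algebra.
From mathcomp Require Import finmap zify ring lra.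
From mathcomp Require Import all_classical all_reals all_analysis.
From mathcomp Require Import measurable_realfun.

Set Implicit Arguments.
Unset Strict Implicit.
Unset Printing Implicit Defensive.

Import Order.TTheory GRing.Theory Num.Theory.
Import numFieldNormedType.Exports.

Local Open Scope classical_set_scope.
Local Open Scope ring_scope.

(** Trajectory by trajectory, the first passage time and the running maximum are
    inverse to each other: the passage above [t] occurs by time [n] exactly when
    the maximum of the first [n] terms exceeds [t]. Hence linear growth of one with
    slope [1 / mu] amounts to linear growth of the other with slope [mu]
    ([max_growth_of_passage], [passage_growth_of_max]).

    The link with the moment of the perturbation rests on the strong law of large
    numbers ([strong_law]), which makes the unperturbed walk grow with slope [mu].

    If the positive part of the perturbation has a finite mean, the strong law
    applied to it shows that positive perturbations are negligible with respect
    to the index, which bounds the maximum from above; applied to the indicator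
    of the event that the perturbation exceeds a fixed level, it provides indices
    close to [n] with a harmless perturbation, which bounds the maximum from below
    ([perturbed_walk_max_growth]).

    Conversely, if the maximum has slope [mu], the perturbation of index [i] is
    eventually at most [i]; the second Borel-Cantelli lemma
    ([summable_of_eventually_avoid]) then makes the sum over [i] of the
    probabilities that the perturbation exceeds [i] finite, and this sum bounds
    the mean of the positive part ([expectation_pos_lty]).

    The strong law follows from the statement that partial sums of steps with a
    negative mean are almost surely bounded above. Let [W n] be the maximum of 0
    and of the first [n] partial sums of the steps that follow the first step [X].
    The maximum with one step more in front is the positive part of [X + W n], and
    it is stochastically larger than [W n], by stationarity. Therefore the mean
    overshoot above any level [L] does not decrease:
    E[(X + W n - L)^+ - (W n - L)^+] >= 0. The integrand is dominated by [|X|], and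
    as [n], then [L] go to infinity it tends to [X] on the event that the [W n] are
    unbounded and to 0 elsewhere. As [X] is independent of that event, its mean
    being negative forces the event to be negligible ([excess_unbounded_null]). *)

(** * Joint laws and independence *)

(** Rectangles form a generating pi-system, so Dynkin's theorem applies. *)
Lemma measure_prod_ext d1 d2 (T1 : measurableType d1) (T2 : measurableType d2)
    (R : realType) (m1 m2 : {measure set (T1 * T2) -> \bar R}) :
  (m1 setT < +oo)%E ->
  (forall A B, measurable A -> measurable B -> m1 (A `*` B) = m2 (A `*` B)) ->
  forall E, measurable E -> m1 E = m2 E.
Proof.
move=> m1oo m12 E mE.
pose C : set (set (T1 * T2)) :=
  [set A `*` B | A in measurable & B in measurable].
apply: (measure_unique C (fun=> setT)) => //.
- exact: measurable_prod_measurableType.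
- move=> _ _ [A mA [B mB <-]] [A' mA' [B' mB' <-]]; rewrite -setXI.
  exists (A `&` A'); first exact: measurableI.
  by exists (B `&` B'); [exact: measurableI|].
- by move=> _; exists setT => //; exists setT => //; rewrite setXTT.
- by rewrite bigcup_const.
- by move=> _ [A mA [B mB <-]]; exact: m12.
Qed.

Section cylinders.
Context d d' (Omega : measurableType d) (T : measurableType d') (R : realType).
Context (P : probability Omega R) (V : nat -> {RV P >-> T}).

(** Events that prescribe the first [m] variables one by one. They are what the
    product rule speaks about directly, and they carry the inductions on blocks
    of variables below. *)
Definition cylinder (m : nat) (A : nat -> set T) : set Omega :=
  \bigcap_(i in `I_m) V i @^-1` A i.

Lemma measurable_cylinder m A : (forall i, measurable (A i)) ->
  measurable (cylinder m A).
Proof.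
move=> mA; apply: fin_bigcap_measurable; [exact: finite_II|move=> i _].
by rewrite -[X in measurable X]setTI; exact: measurable_funPT.
Qed.

Lemma cylinderS m A : cylinder m.+1 A = cylinder m A `&` V m @^-1` A m.
Proof.
rewrite /cylinder; apply/seteqP; split => [w H|w [H1 H2] i /=].
  by split => [i /= im|]; apply: H => //=; rewrite ltnS ltnW.
by rewrite ltnS leq_eqVlt => /orP[/eqP->//|im]; exact: H1.
Qed.

Lemma eq_cylinder m A B : (forall i, (i < m)%N -> A i = B i) ->
  cylinder m A = cylinder m B.
Proof.
move=> AB; rewrite /cylinder; apply: eq_bigcapr => i /= im.
by rewrite AB.
Qed.

Lemma cylinder_prob m A : mutually_independent V -> (forall i, measurable (A i)) ->
  P (cylinder m A) = (\prod_(i < m) P (V i @^-1` A i))%E.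
Proof.
move=> Vind mA.
have := Vind [fset i in iota 0 m]%fset A (fun i _ => mA i).
rewrite (perm_big (index_iota 0 m)) ?big_mkord => [<-|]; last first.
  apply: uniq_perm => [||i]; rewrite ?fset_uniq ?iota_uniq//.
  by rewrite !inE mem_index_iota mem_iota.
rewrite /cylinder (_ : `I_m = [set` [fset i in iota 0 m]%fset])//; apply/seteqP; split=> i /=;
  by rewrite !inE/= mem_iota.
Qed.

Lemma cylinder_probS m A B : mutually_independent V ->
  (forall i, measurable (A i)) -> measurable B ->
  P (cylinder m A `&` V m @^-1` B) = (P (cylinder m A) * P (V m @^-1` B))%E.
Proof.
move=> Vind mA mB; pose A' i := if (i < m)%N then A i else B.
have A'A i : (i < m)%N -> A' i = A i by rewrite /A' => ->.
rewrite -(eq_cylinder A'A) (_ : B = A' m); last by rewrite /A' ltnn.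
have mA' i : measurable (A' i) by rewrite /A'; case: ifP.
by rewrite -cylinderS !cylinder_prob// big_ord_recr.
Qed.

End cylinders.

Section joint.
Local Open Scope ereal_scope.
Context d d1 d2 (Omega : measurableType d) (T1 : measurableType d1)
  (T2 : measurableType d2) (R : realType) (P : probability Omega R).
Variables (X X' : Omega -> T1) (Y Y' : Omega -> T2).
Hypotheses (mX : measurable_fun setT X) (mX' : measurable_fun setT X').
Hypotheses (mY : measurable_fun setT Y) (mY' : measurable_fun setT Y').

Lemma joint_law_eq :
  (forall A B, measurable A -> measurable B ->
     P (X @^-1` A `&` Y @^-1` B) = P (X' @^-1` A `&` Y' @^-1` B)) ->
  forall E, measurable E ->
    P ((fun w => (X w, Y w)) @^-1` E) = P ((fun w => (X' w, Y' w)) @^-1` E).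
Proof.
move=> XY E mE.
have mXY := measurable_fun_pair mX mY; have mXY' := measurable_fun_pair mX' mY'.
pose Z : {mfun Omega >-> (T1 * T2)%type} := mfun_Sub (mem_set mXY).
pose Z' : {mfun Omega >-> (T1 * T2)%type} := mfun_Sub (mem_set mXY').
apply: (@measure_prod_ext _ _ _ _ _ (distribution P Z) (distribution P Z')) => //.
exact: le_lt_trans (probability_le1 (distribution P Z) measurableT) (ltry _).
Qed.

(** Independence of [D] from the pair [(X, Y)] can be tested on rectangles:
    compare the law of the pair under [P] restricted to [D] with the law under
    [P] scaled by [P D]. *)
Lemma joint_indep_event D : measurable D ->
  (forall A B, measurable A -> measurable B ->
     P (D `&` (X @^-1` A `&` Y @^-1` B)) = P D * P (X @^-1` A `&` Y @^-1` B)) ->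
  forall E, measurable E ->
    P (D `&` (fun w => (X w, Y w)) @^-1` E) =
    P D * P ((fun w => (X w, Y w)) @^-1` E).
Proof.
move=> mD XY E mE.
have mXY := measurable_fun_pair mX mY.
pose Z : {mfun Omega >-> (T1 * T2)%type} := mfun_Sub (mem_set mXY).
have Dge : (0 <= fine (P D))%R by apply: fine_ge0.
have PDE : (fine (P D))%:E = P D by rewrite fineK// fin_num_measure.
rewrite setIC; have := @measure_prod_ext _ _ _ _ _ (pushforward (mrestr P mD) Z)
  (mscale (NngNum Dge) (distribution P Z)) _ _ E mE.
rewrite /= /distribution /pushforward /mrestr /mscale/= PDE => ->//.
- by rewrite preimage_setT setTI; apply: le_lt_trans (probability_le1 P mD) (ltry _).
- by move=> A B mA mB; rewrite setIC; exact: XY.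
Qed.

End joint.

(** * The excess of a block of steps *)

Section excess.
Context d d' (Omega : measurableType d) (T : measurableType d') (R : realType).
Context (P : probability Omega R) (V : nat -> {RV P >-> T}).
Context (f : T -> R).
Hypothesis mf : measurable_fun setT f.

(** The maximum of 0 and of the first [n] partial sums of the steps [f (V m)],
    [f (V m.+1)], ... Peeling off the first step rather than the last one makes
    the function nondecreasing in [n] at each sample point, and exhibits it as a
    function of [V m] and of a quantity which depends on later steps only. *)
Fixpoint excess (n m : nat) (w : Omega) : R :=
  if n is n'.+1 then Num.max 0 (f (V m w) + excess n' m.+1 w) else 0.

Lemma excess_ge0 n m w : 0 <= excess n m w.
Proof. by case: n => [|n] //=; rewrite le_max lexx. Qed.

Lemma excess_nd m w : nondecreasing_seq (fun n => excess n m w).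
Proof.
apply/nondecreasing_seqP => n; elim: n m => [|n IH] m; first exact: excess_ge0.
by rewrite /= ge_max !le_max lexx/= lerD2l IH orbT.
Qed.

Lemma sum_le_excess n m w : \sum_(i < n) f (V (m + i)%N w) <= excess n m w.
Proof.
elim: n m => [|n IH] m; first by rewrite big_ord0.
rewrite big_ord_recl /= addn0 le_max lerD2l; apply/orP; right.
by under eq_bigr do rewrite /bump/= addnCA add1n -addSn; exact: IH.
Qed.

Lemma measurable_excess n m : measurable_fun setT (excess n m).
Proof.
elim: n m => [|n IH] m /=; first exact: measurable_cst.
apply: measurable_maxr; first exact: measurable_cst.
apply: measurable_funD; last exact: IH.
by apply: measurableT_comp => //; exact: measurable_funPT.
Qed.

Let step (z : T * R) : R := Num.max 0 (f z.1 + z.2).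

Let measurable_step : measurable_fun setT step.
Proof.
apply: measurable_maxr; first exact: measurable_cst.
by apply: measurable_funD => //; exact: measurableT_comp.
Qed.

Let excess_step n m D : excess n.+1 m @^-1` D =
  (fun w => (V m w, excess n m.+1 w)) @^-1` (step @^-1` D).
Proof. by []. Qed.

Let measurable_preimT d1 d2 (T1 : measurableType d1) (T2 : measurableType d2)
  (g : T1 -> T2) D : measurable_fun setT g -> measurable D ->
  measurable (g @^-1` D).
Proof. by move=> mg mD; rewrite -[X in measurable X]setTI; exact: mg. Qed.

Hypothesis Vind : mutually_independent V.

(** Induction on the length of the block: the excess is a function of the pair
    formed by [V m] and the excess of the remaining steps; on rectangles, the
    prescription of [V m] joins the cylinder and the induction hypothesis
    applies with [m.+1]. *)
Lemma excess_indep_cylinder n m A D :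
  (forall i, measurable (A i)) -> measurable D ->
  P (cylinder V m A `&` excess n m @^-1` D) =
  (P (cylinder V m A) * P (excess n m @^-1` D))%E.
Proof.
elim: n m A D => [|n IH] m A D mA mD.
  rewrite /= (_ : (fun=> 0) @^-1` D = if 0 \in D then setT else set0); last first.
    by rewrite preimage_cst.
  by case: ifP => _; rewrite ?setIT ?setI0 ?probability_setT ?mule1 ?measure0 ?mule0.
rewrite excess_step.
have mV : measurable_fun setT (V m) by exact: measurable_funPT.
apply: joint_indep_event => //.
- exact: measurable_excess.
- exact: measurable_cylinder.
- have key A' B C : (forall i, measurable (A' i)) -> measurable B ->
      measurable C ->
      P (cylinder V m A' `&` (V m @^-1` B `&` excess n m.+1 @^-1` C)) =
      (P (cylinder V m A') * (P (V m @^-1` B) * P (excess n m.+1 @^-1` C)))%E.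
    move=> mA' mB mC; pose A'' i := if (i < m)%N then A' i else B.
    have A''A i : (i < m)%N -> A'' i = A' i by rewrite /A'' => ->.
    have mA'' i : measurable (A'' i) by rewrite /A''; case: ifP.
    have A''m : A'' m = B by rewrite /A'' ltnn.
    rewrite setIA -(eq_cylinder V A''A) -A''m -cylinderS IH//.
    by rewrite cylinderS cylinder_probS// muleA.
  (* The empty prescription turns [key] into independence of the two components. *)
  move=> B C mB mC; rewrite key//; congr (_ * _)%E.
  have := key (fun=> setT) B C (fun=> measurableT) mB mC.
  rewrite /cylinder bigcapT// setTI probability_setT mul1e => ->//.
- exact: measurable_preimT.
Qed.

Lemma excess_indep0 n C D : measurable C -> measurable D ->
  P (V 0%N @^-1` C `&` excess n 1 @^-1` D) =
  (P (V 0%N @^-1` C) * P (excess n 1 @^-1` D))%E.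
Proof.
move=> mC mD; have := @excess_indep_cylinder n 1 (fun=> C) D (fun=> mC) mD.
by rewrite /cylinder II1 bigcap_set1.
Qed.

Hypothesis Vlaw : forall n m, same_law (V n) (V m).

(** Stationarity: both pairs (first step, excess of the rest) have independent
    components, with the same laws by induction. *)
Lemma excess_law n m k D : measurable D ->
  P (excess n m @^-1` D) = P (excess n k @^-1` D).
Proof.
elim: n m k D => [//|n IH] m k D mD; rewrite !excess_step.
have mV j : measurable_fun setT (V j) by exact: measurable_funPT.
apply: joint_law_eq => //; try exact: measurable_excess.
  have key j B C : measurable B -> measurable C ->
      P (V j @^-1` B `&` excess n j.+1 @^-1` C) =
      (P (V j @^-1` B) * P (excess n j.+1 @^-1` C))%E.
    move=> mB mC; pose A i := if i == j then B else setT.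
    have mA i : measurable (A i) by rewrite /A; case: ifP.
    have := @excess_indep_cylinder n j.+1 A C mA mC.
    rewrite cylinderS {2 4}/A eqxx (_ : cylinder V j A = setT) ?setTI//.
    by rewrite -subTset => w _ i /= ij; rewrite /A ltn_eqF.
  move=> B C mB mC; rewrite !key//; congr (_ * _)%E; last exact: IH.
  exact: Vlaw.
exact: measurable_preimT.
Qed.

End excess.

(** * Independence and integrals *)

Section independence_limits.
Local Open Scope ereal_scope.
Context d (Omega : measurableType d) (R : realType) (P : probability Omega R).

Lemma indep_bigcup B (F : (set Omega)^nat) : measurable B ->
  (forall n, measurable (F n)) -> nondecreasing_seq F ->
  (forall n, P (B `&` F n) = P B * P (F n)) ->
  P (B `&` \bigcup_n F n) = P B * P (\bigcup_n F n).
Proof.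
move=> mB mF ndF BF; have PB : P B \is a fin_num by rewrite fin_num_measure.
have mUF : measurable (\bigcup_n F n) by exact: bigcup_measurable.
have cF := cvgeZl PB (nondecreasing_cvg_mu (mu := P) mF mUF ndF).
apply/esym; apply: (cvg_unique _ cF) => //; rewrite setI_bigcupr.
have -> : (fun n => P B * (P \o F) n) = P \o (fun n => B `&` F n).
  by apply/funext => n /=; rewrite BF.
apply: nondecreasing_cvg_mu => [n||]; first exact: measurableI.
  by rewrite -setI_bigcupr; exact: measurableI.
by move=> m n /ndF /subsetPset mn; apply/subsetPset; exact: setIS.
Qed.

Lemma indep_bigcap B (F : (set Omega)^nat) : measurable B ->
  (forall n, measurable (F n)) -> nonincreasing_seq F ->
  (forall n, P (B `&` F n) = P B * P (F n)) ->
  P (B `&` \bigcap_n F n) = P B * P (\bigcap_n F n).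
Proof.
move=> mB mF niF BF; have PB : P B \is a fin_num by rewrite fin_num_measure.
have mIF : measurable (\bigcap_n F n) by exact: bigcapT_measurable.
have Pfin A : measurable A -> P A < +oo.
  by move=> mA; exact: le_lt_trans (probability_le1 P mA) (ltry _).
have cF := cvgeZl PB (nonincreasing_cvg_mu (Pfin _ (mF 0%N)) mF mIF niF).
apply/esym; apply: (cvg_unique _ cF) => //.
have -> : (fun n => P B * (P \o F) n) = P \o (fun n => B `&` F n).
  by apply/funext => n /=; rewrite BF.
have -> : B `&` \bigcap_n F n = \bigcap_n (B `&` F n) by rewrite bigcapIr.
apply: nonincreasing_cvg_mu => [|n||].
- by apply: Pfin; exact: measurableI.
- exact: measurableI.
- by apply: bigcapT_measurable => n; exact: measurableI.
- by move=> m n /niF /subsetPset mn; apply/subsetPset; exact: setIS.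
Qed.

Context d' (T : measurableType d').

(** The law of [Z] under [P] restricted to [A] is the law of [Z] scaled by
    [P A]. *)
Lemma ge0_integral_indep_event (Z : {RV P >-> T}) A (g : T -> \bar R) :
  measurable A ->
  (forall C, measurable C -> P (Z @^-1` C `&` A) = P (Z @^-1` C) * P A) ->
  measurable_fun setT g -> (forall t, 0 <= g t) ->
  \int[P]_(w in A) g (Z w) = P A * \int[P]_w g (Z w).
Proof.
move=> mA ZA mg g0.
have PA0 : (0 <= fine (P A))%R by apply: fine_ge0.
have PAE : (fine (P A))%:E = P A by rewrite fineK// fin_num_measure.
have mgZ : measurable_fun setT (g \o Z).
  by apply: measurableT_comp => //; exact: measurable_funPT.
rewrite (@eq_measure_integral _ _ _ A (mrestr P mA)); last first.
  by move=> C mC CA; rewrite /= /mrestr setIidl.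
have -> : \int[mrestr P mA]_(w in A) g (Z w) = \int[mrestr P mA]_w g (Z w).
  rewrite [RHS](ge0_negligible_integral (N := ~` A))//; last 2 first.
    exact: measurableC.
    by rewrite /= /mrestr setICl measure0.
  by rewrite setTD setCK.
rewrite -(ge0_integral_pushforward (phi := Z) _ (mrestr P mA) measurableT)//.
rewrite (eq_measure_integral (mscale (NngNum PA0) (distribution P Z))); last first.
  move=> C mC _; rewrite /= /mscale/= /pushforward /mrestr/= PAE muleC.
  exact: ZA.
rewrite ge0_integral_mscale//= PAE; congr (_ * _).
by rewrite ge0_integral_distribution.
Qed.

Lemma integral_indep_event (Z : {RV P >-> T}) A (g : T -> R) :
  measurable A ->
  (forall C, measurable C -> P (Z @^-1` C `&` A) = P (Z @^-1` C) * P A) ->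
  measurable_fun setT g -> P.-integrable setT (fun w => (g (Z w))%:E) ->
  \int[P]_(w in A) (g (Z w))%:E = P A * \int[P]_w (g (Z w))%:E.
Proof.
move=> mA ZA mg ig; have mEg : measurable_fun setT (EFin \o g).
  exact/measurable_EFinP.
have PA : P A \is a fin_num by exact: fin_num_measure.
have idef := integrable_add_def measurableT ig.
rewrite integralE [in RHS]integralE [RHS](muleBr PA idef).
have -> : (fun w => (g (Z w))%:E)^\+ = fun w => (EFin \o g)^\+ (Z w).
  by apply/funext => w; rewrite !funeposE.
have -> : (fun w => (g (Z w))%:E)^\- = fun w => (EFin \o g)^\- (Z w).
  by apply/funext => w; rewrite !funenegE.
rewrite (ge0_integral_indep_event (g := (EFin \o g)^\+) mA ZA)//.
  rewrite (ge0_integral_indep_event (g := (EFin \o g)^\-) mA ZA)//.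
  exact: measurable_funeneg.
exact: measurable_funepos.
Qed.

Lemma same_law_integrable (X Y : {RV P >-> T}) (g : T -> R) :
  same_law X Y -> measurable_fun setT g ->
  P.-integrable setT (fun w => (g (X w))%:E) ->
  P.-integrable setT (fun w => (g (Y w))%:E).
Proof.
move=> XY mg /integrableP[_ iX]; apply/integrableP; split.
  by apply/measurable_EFinP; apply: measurableT_comp => //; exact: measurable_funPT.
have mEg : measurable_fun setT (fun t => `|(g t)%:E|).
  by apply: measurableT_comp => //; exact/measurable_EFinP.
rewrite -(ge0_integral_distribution Y mEg)//.
rewrite (eq_measure_integral (distribution P X)) ?ge0_integral_distribution//.
by move=> A mA _; apply/esym; exact: XY.
Qed.

Lemma same_law_integral (X Y : {RV P >-> T}) (g : T -> R) :
  same_law X Y -> measurable_fun setT g ->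
  P.-integrable setT (fun w => (g (X w))%:E) ->
  \int[P]_w (g (X w))%:E = \int[P]_w (g (Y w))%:E.
Proof.
move=> XY mg ig; have mEg : measurable_fun setT (EFin \o g) by exact/measurable_EFinP.
rewrite -(integral_distribution (X := X) mEg)//.
rewrite -(integral_distribution (X := Y) mEg)//; last first.
  exact: same_law_integrable XY mg ig.
by apply: eq_measure_integral => A mA _; exact: XY.
Qed.

End independence_limits.

(** * Negative drift *)

Section overshoot.
Context (R : realType).
Implicit Types x m L : R.

(** The change of the overshoot above the level [L] when a step [x] is put in
    front of steps whose excess is [m]. It is dominated by [|x|], equal to [x]
    when [m] is far above [L], and null when [m] is far below [L]. *)
Definition overshoot x m L : R := Num.max 0 (x + m - L) - Num.max 0 (m - L).

Lemma overshoot_le x m L : `|overshoot x m L| <= `|x|.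
Proof.
rewrite /overshoot ler_norml; have := ler_norm x; have := ler_norm (- x).
rewrite normrN; case: (lerP 0 (x + m - L)); case: (lerP 0 (m - L)); lra.
Qed.

Lemma overshoot_high x m L : L + `|x| <= m -> overshoot x m L = x.
Proof.
rewrite /overshoot; have := ler_norm x; have := ler_norm (- x).
by rewrite normrN; case: (lerP 0 (x + m - L)); case: (lerP 0 (m - L)); lra.
Qed.

Lemma overshoot_low x m L : m + `|x| <= L -> overshoot x m L = 0.
Proof.
rewrite /overshoot; have := ler_norm x; have := ler_norm (- x).
by rewrite normrN; case: (lerP 0 (x + m - L)); case: (lerP 0 (m - L)); lra.
Qed.

Lemma overshoot_cvg x L (u : R^nat) :
  cvgn u -> cvgn (fun n => overshoot x (u n) L).
Proof.
move=> cu; pose h m := (`|x + m - L| - `|m - L| + x) / 2.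
have -> : (fun n => overshoot x (u n) L) = h \o u.
  (* Both positive parts are written through absolute values, which are continuous. *)
  apply/funext => n /=; rewrite /overshoot /h.
  case: (lerP 0 (x + u n - L)) => h1; case: (lerP 0 (u n - L)) => h2;
    (try rewrite (ger0_norm h1)); (try rewrite (ger0_norm h2));
    (try rewrite (ltr0_norm h1)); (try rewrite (ltr0_norm h2)); lra.
apply: is_cvgM; last exact: is_cvg_cst.
apply: is_cvgD; last exact: is_cvg_cst.
apply: is_cvgB; apply: is_cvg_norm; apply: is_cvgB; try exact: is_cvg_cst; try exact: cu.
by apply: is_cvgD => //; exact: is_cvg_cst.
Qed.

End overshoot.

Lemma integral_cvg_ge0 d (Omega : measurableType d) (R : realType)
    (P : {measure set Omega -> \bar R}) (h : nat -> Omega -> R)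
    (l b : Omega -> R) :
  (forall n, measurable_fun setT (h n)) ->
  (forall w, h n w @[n --> \oo] --> l w) ->
  P.-integrable setT (EFin \o b) -> (forall n w, `|h n w| <= b w) ->
  (forall n, 0 <= \int[P]_w (h n w)%:E)%E -> (0 <= \int[P]_w (l w)%:E)%E.
Proof.
move=> mh hl ib hb h0.
have ml : measurable_fun setT l by apply: (measurable_fun_cvg mh) => w _; exact: hl.
have mEh n : measurable_fun setT (EFin \o h n) by exact/measurable_EFinP.
have mEl : measurable_fun setT (EFin \o l) by exact/measurable_EFinP.
have hl' : {ae P, forall w, setT w -> (EFin \o h n) w @[n --> \oo] --> (EFin \o l) w}.
  by apply: aeW => w _; apply: cvg_EFin; [exact: nearW|exact: hl].
have hb' : {ae P, forall w n, setT w -> (`|(EFin \o h n) w| <= (EFin \o b) w)%E}.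
  by apply: aeW => w n _; rewrite /= lee_fin.
have [_ _ lim] := dominated_convergence measurableT mEh mEl hl' ib hb'.
by apply: (cvge_ge (F := \oo) _ lim); exact: nearW.
Qed.

Section negative_drift.
Context d d' (Omega : measurableType d) (T : measurableType d') (R : realType).
Context (P : probability Omega R) (V : nat -> {RV P >-> T}).
Context (f : T -> R).
Hypothesis mf : measurable_fun setT f.
Hypothesis Vind : mutually_independent V.
Hypothesis Vlaw : forall n m, same_law (V n) (V m).
Hypothesis if0 : P.-integrable setT (fun w => (f (V 0 w))%:E).

Let W n m := excess V f n m.
Let mW n m : measurable_fun setT (W n m) := measurable_excess V mf n m.
Let X0 w := f (V 0%N w).

Let mX0 : measurable_fun setT X0.
Proof. by apply: measurableT_comp => //; exact: measurable_funPT. Qed.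

Lemma integrable_excess n m : P.-integrable setT (fun w => (W n m w)%:E).
Proof.
elim: n m => [|n IH] m; first exact: integrable0.
have ifm : P.-integrable setT (fun w => (f (V m w))%:E).
  by apply: same_law_integrable if0.
have := integrableD measurableT ifm (IH m.+1); apply: le_integrable => //.
  by apply/measurable_EFinP; exact: mW.
move=> w _; rewrite lee_fin /W /= maxEle; case: ifP => _ //.
by rewrite normr0 normr_ge0.
Qed.

Definition excess_unbounded : set Omega :=
  \bigcap_L \bigcup_n [set w | L%:R < W n 1 w].

Let measurable_level L n : measurable [set w | (L%:R : R) < W n 1 w].
Proof.
rewrite (_ : [set w | _] = W n 1 @^-1` `]L%:R, +oo[); last first.
  by apply/seteqP; split => w /=; rewrite in_itv/= andbT.
by rewrite -[X in measurable X]setTI; apply: mW.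
Qed.

Lemma measurable_excess_unbounded : measurable excess_unbounded.
Proof. by apply: bigcapT_measurable => L; exact: bigcup_measurable. Qed.

(** The event depends on the steps of index at least 1 only, through a countable
    combination of events on finite blocks. *)
Lemma excess_unbounded_indep C : measurable C ->
  P (V 0%N @^-1` C `&` excess_unbounded) =
  (P (V 0%N @^-1` C) * P excess_unbounded)%E.
Proof.
move=> mC; have mVC : measurable (V 0%N @^-1` C).
  by rewrite -[X in measurable X]setTI; exact: measurable_funPT.
apply: indep_bigcap => // [L|L1 L2 L12|L].
- exact: bigcup_measurable.
- apply/subsetPset => w [n _ /= h]; exists n => //=.
  by apply: le_lt_trans h; rewrite ler_nat.
- apply: indep_bigcup => // [n1 n2 n12|n].
  + apply/subsetPset => w /= /lt_le_trans; apply.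
    exact: (excess_nd V f 1 w).
  + have -> : [set w | (L%:R : R) < W n 1 w] = W n 1 @^-1` `]L%:R, +oo[.
      by apply/seteqP; split => w /=; rewrite in_itv/= andbT.
    exact: excess_indep0.
Qed.

Let D L n w := overshoot (X0 w) (W n 1 w) L.

Let mD L n : measurable_fun setT (D L n).
Proof.
apply: measurable_funB; apply: measurable_maxr; try exact: measurable_cst.
  by apply: measurable_funB => //; apply: measurable_funD => //; exact: mW.
by apply: measurable_funB => //; exact: mW.
Qed.

Let int_level n m L : 0 <= L ->
  P.-integrable setT (fun w => (Num.max 0 (W n m w - L))%:E).
Proof.
move=> L0; apply: le_integrable (integrable_excess n m) => //.
  apply/measurable_EFinP; apply: measurable_maxr => //.
  by apply: measurable_funB => //; exact: mW.
move=> w _; rewrite /= lee_fin (ger0_norm (excess_ge0 _ _ _ _ _)).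
have := excess_ge0 V f n m w; rewrite -/(W n m w) => W0.
by rewrite ger0_norm ?le_max ?lexx// ge_max; apply/andP; split; lra.
Qed.

(** The integral is the mean overshoot of the excess of [n.+1] steps minus that of
    [n] steps: the block which starts at index 1 may be replaced by the one which
    starts at 0, because both have the same law. *)
Lemma integral_overshoot_ge0 L n : 0 <= L -> (0 <= \int[P]_w (D L n w)%:E)%E.
Proof.
move=> L0.
have DE w : D L n w = Num.max 0 (W n.+1 0 w - L) - Num.max 0 (W n 1 w - L).
  rewrite /D /overshoot /W /= -/(X0 w); congr (_ - _).
  case: (lerP 0 (X0 w + excess V f n 1 w)) => h0 //.
  by rewrite !max_l //; lra.
under eq_integral do rewrite DE EFinB.
rewrite integralB_EFin//; try exact: int_level.
rewrite sube_ge0; last first.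
  by rewrite orbC (integrable_fin_num _ (int_level _ _ L0)).
have mg : measurable_fun setT (fun x : R => Num.max 0 (x - L)).
  by apply: measurable_maxr => //; apply: measurable_funB.
pose RW m : {RV P >-> R} := mfun_Sub (mem_set (mW n m)).
have <- : (\int[P]_w (Num.max 0 (RW 0%N w - L))%:E =
           \int[P]_w (Num.max 0 (RW 1%N w - L))%:E)%E.
  apply: (same_law_integral (X := RW 0%N) (Y := RW 1%N) (g := fun x => Num.max 0 (x - L))) => //.
    by move=> A mA; exact: (excess_law mf Vind Vlaw n 0 1 mA).
  exact: int_level.
apply: ge0_le_integral => //.
- by move=> w _; rewrite lee_fin le_max lexx.
- by case/integrableP: (int_level n 0 L0).
- by case/integrableP: (int_level n.+1 0 L0).
- move=> w _; rewrite lee_fin ge_max !le_max lexx/=; apply/orP; right.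
  by rewrite lerD2r; apply: (excess_nd V f 0 w (leqnSn n)).
Qed.

Let bounded_cvg L w : cvgn (fun n => D L n w).
Proof.
have [[M WM]|unb] := pselect (exists M, forall n, W n 1 w <= M).
  apply: overshoot_cvg; apply: nondecreasing_is_cvgn.
    exact: (excess_nd V f 1 w).
  by exists M => _ [n _ <-].
apply/cvg_ex; exists (X0 w); apply: cvg_near_cst.
have [N WN] : exists N, L + `|X0 w| <= W N 1 w.
  apply: contrapT => nN; apply: unb; exists (L + `|X0 w|) => n.
  by rewrite leNgt; apply/negP => h; apply: nN; exists n; exact: ltW.
exists N => // n /= Nn; apply: overshoot_high; apply: (le_trans WN).
exact: (excess_nd V f 1 w).
Qed.

Let G L w := limn (fun n => D L n w).

Let DG L w : D L n w @[n --> \oo] --> G L w.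
Proof. exact: bounded_cvg. Qed.

Let iX0 : P.-integrable setT (fun w => `|X0 w|%:E).
Proof.
apply: le_integrable if0 => //.
  by apply/measurable_EFinP; exact: measurableT_comp.
by move=> w _; rewrite /= lee_fin normr_id.
Qed.

Let G_le L w : `|G L w| <= `|X0 w|.
Proof.
rewrite -lim_norm; last exact: bounded_cvg.
apply: limr_le; first by apply: is_cvg_norm; exact: bounded_cvg.
by apply: nearW => n; exact: overshoot_le.
Qed.

Let mG L : measurable_fun setT (G L).
Proof. by apply: (measurable_fun_cvg (mD L)) => w _; exact: DG. Qed.

Let integral_G_ge0 (k : nat) : (0 <= \int[P]_w (G k%:R w)%:E)%E.
Proof.
apply: (integral_cvg_ge0 (mD k%:R) _ iX0) => [w|n w|n].
- exact: DG.
- exact: overshoot_le.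
- exact: integral_overshoot_ge0.
Qed.

Let Glim w : G k%:R w @[k --> \oo] --> (X0 \_ excess_unbounded) w.
Proof.
rewrite patchE; case: ifPn => [/set_mem unb|/negP bnd]; apply: cvg_near_cst.
  exists 0%N => // k _ /=; apply/cvg_lim => //; apply: cvg_near_cst.
  pose K := (Num.truncn (k%:R + `|X0 w|)).+1.
  have [N _ /= WN] := unb K I.
  exists N => // n /= Nn; apply: overshoot_high.
  apply/ltW/(lt_trans (truncnS_gt _))/(lt_le_trans WN).
  exact: (excess_nd V f 1 w Nn).
have [K WK] : exists K : nat, forall n, W n 1 w <= K%:R.
  apply: contrapT => nK; apply: bnd; apply: mem_set => L _.
  apply: contrapT => nL; apply: nK; exists L => n.
  by rewrite leNgt; apply/negP => h; apply: nL; exists n.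
exists (Num.truncn (K%:R + `|X0 w|)).+1 => // k /= Kk.
apply/cvg_lim => //; apply: cvg_near_cst; apply: nearW => n.
apply: overshoot_low; apply: (@le_trans _ _ (K%:R + `|X0 w|)).
  by rewrite lerD2r.
by apply: (le_trans (ltW (truncnS_gt _))); rewrite ler_nat.
Qed.

(** Let [n], then [L] tend to infinity in [integral_overshoot_ge0]: the integrand
    tends to the first step on the event [A] that the excess is unbounded and to
    0 elsewhere. By independence the limit inequality reads
    0 <= P(A) E[f(V_0)], which forces P(A) = 0 when the mean is negative. *)
Lemma excess_unbounded_null : (\int[P]_w (f (V 0%N w))%:E < 0)%E ->
  P excess_unbounded = 0%E.
Proof.
move=> drift; have mA := measurable_excess_unbounded.
have : (0 <= \int[P]_w ((X0 \_ excess_unbounded) w)%:E)%E.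
  apply: (integral_cvg_ge0 (fun k => mG k%:R) Glim iX0) => [k w|k].
    exact: G_le.
  exact: integral_G_ge0.
have -> : (fun w => ((X0 \_ excess_unbounded) w)%:E) =
    (fun w => (X0 w)%:E) \_ excess_unbounded.
  by apply/funext => w; rewrite !patchE; case: ifP.
rewrite -integral_mkcond (integral_indep_event mA excess_unbounded_indep mf if0).
move=> h; apply/eqP; rewrite eq_le measure_ge0 andbT leNgt; apply/negP => PA.
by move: h; rewrite leNgt pmule_rlt0 ?drift.
Qed.

End negative_drift.

(** * The strong law of large numbers *)

(** Equivalent to convergence of [u n / n] to [l], see [cvg_linear_growth]; the
    additive constant makes the estimate hold at every index, so that growth
    hypotheses can be combined without tracking ranks. *)
Definition linear_growth (R : realType) (u : nat -> R) (l : R) :=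
  forall e : R, 0 < e -> exists C : R, forall n, `|u n - n%:R * l| <= n%:R * e + C.

Section strong_law.
Context d d' (Omega : measurableType d) (T : measurableType d') (R : realType).
Context (P : probability Omega R) (V : nat -> {RV P >-> T}) (Y : {RV P >-> T}).
Hypothesis Vcopies : independent_copies V Y.

Let Vind : mutually_independent V. Proof. by case: Vcopies. Qed.

Let Vlaw n m : same_law (V n) (V m).
Proof. by case: Vcopies => _ VY A mA; rewrite (VY n)// (VY m). Qed.

Let YV : same_law Y (V 0%N).
Proof. by case: Vcopies => _ VY A mA; rewrite (VY 0%N). Qed.

(** The excess over the steps of index at least 1 dominates the partial sums up
    to the first step, and it is almost surely bounded. *)
Lemma negative_drift_bounded (f : T -> R) : measurable_fun setT f ->
  P.-integrable setT (fun w => (f (Y w))%:E) ->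
  (\int[P]_w (f (Y w))%:E < 0)%E ->
  {ae P, forall w, exists C, forall n, \sum_(i < n) f (V i w) <= C}.
Proof.
move=> mf iY drift.
have i0 := same_law_integrable YV mf iY.
have null : P (excess_unbounded V f) = 0%E.
  apply: excess_unbounded_null => //.
  by rewrite -(same_law_integral YV mf iY).
exists (excess_unbounded V f); split => //.
  exact: measurable_excess_unbounded.
move=> w /= noC L _ /=; apply: contrapT => noL; apply: noC.
have L0 : 0 <= (L%:R : R) by [].
exists (`|f (V 0%N w)| + L%:R) => -[|n]; first by rewrite big_ord0 addr_ge0.
rewrite big_ord_recl/= lerD ?ler_norm//.
apply: (@le_trans _ _ (excess V f n 1 w)).
  exact: sum_le_excess.
by rewrite leNgt; apply/negP => h; apply: noL; exists n.
Qed.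

(** Subtracting [m + e] from the steps turns the drift negative, so the recentred
    partial sums are bounded above. *)
Lemma strong_law_upper (f : T -> R) (m e : R) : measurable_fun setT f ->
  P.-integrable setT (fun w => (f (Y w))%:E) ->
  (\int[P]_w (f (Y w))%:E = m%:E)%E -> 0 < e ->
  {ae P, forall w, exists C, forall n,
    \sum_(i < n) f (V i w) <= n%:R * (m + e) + C}.
Proof.
move=> mf iY Em e0.
have ic : P.-integrable setT (fun=> (m + e)%:E).
  exact: finite_measure_integrable_cst.
have iE : (fun w => (f (Y w) - (m + e))%:E) =
    (fun w => (f (Y w))%:E - (m + e)%:E)%E by [].
have : {ae P, forall w, exists C, forall n,
    \sum_(i < n) (f (V i w) - (m + e)) <= C}.
  apply: (negative_drift_bounded (f := fun t => f t - (m + e))).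
  - exact: measurable_funB.
  - by rewrite iE; exact: integrableB.
  - rewrite iE integralB_EFin// Em integral_cst//= probability_setT mule1.
    by rewrite -EFinB lte_fin; lra.
apply: filterS => w [C HC]; exists C => n; have := HC n.
by rewrite sumrB sumr_const card_ord -mulr_natl; lra.
Qed.

(** The one-sided estimate, used for [f] and for [- f], gives the two-sided one
    for each fixed slope [1 / (k + 1)]; countably many slopes suffice. *)
Theorem strong_law (f : T -> R) (m : R) : measurable_fun setT f ->
  P.-integrable setT (fun w => (f (Y w))%:E) ->
  (\int[P]_w (f (Y w))%:E = m%:E)%E ->
  {ae P, forall w, linear_growth (fun n => \sum_(i < n) f (V i w)) m}.
Proof.
move=> mf iY Em.
have iNE : (fun w => (- f (Y w))%:E) = (fun w => - (f (Y w))%:E)%E by [].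
have iN : P.-integrable setT (fun w => (- f (Y w))%:E).
  by rewrite iNE; exact: integrableN.
have EN : (\int[P]_w (- f (Y w))%:E = (- m)%:E)%E.
  rewrite iNE integralN ?Em//; exact: integrable_add_def.
have near_k : {ae P, forall w, forall k : nat, exists C, forall n,
    `|\sum_(i < n) f (V i w) - n%:R * m| <= n%:R * k.+1%:R^-1 + C}.
  apply/ae_foralln => k; have k0 : 0 < (k.+1%:R : R)^-1 by rewrite invr_gt0.
  have mN := measurableT_comp (@oppr_measurable R _) mf.
  have := strong_law_upper (f := fun t => - f t) mN iN EN k0.
  have := strong_law_upper mf iY Em k0.
  apply: filterS2 => w [C HC] [C' HC']; exists (Num.max C C') => n.
  have CM : C <= Num.max C C' by rewrite le_max lexx.
  have CM' : C' <= Num.max C C' by rewrite le_max lexx orbT.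
  have := HC n; have := HC' n; rewrite sumrN ler_norml => h1 h2.
  move: h1 h2 CM CM'; rewrite !mulrDr mulrN.
  move: (\sum_(i < n) _) (n%:R * _) (n%:R * m) (Num.max _ _) => S t u M.
  by move=> h1 h2 CM CM'; apply/andP; split; lra.
apply: filterS near_k => w Hw e e0.
have [k ke] : exists k : nat, k.+1%:R^-1 <= e.
  exists (Num.truncn e^-1); rewrite -[e]invrK lef_pV2 ?posrE ?invr_gt0//.
  by rewrite invrK; apply/ltW/truncnS_gt.
have [C HC] := Hw k; exists C => n; apply: (le_trans (HC n)).
by rewrite lerD2r ler_wpM2l.
Qed.

End strong_law.

(** * Inversion of the first passage time *)

Lemma cvg_linear_growth (R : realType) (u : nat -> R) (l : R) :
  (n%:R^-1 * u n @[n --> \oo] --> l) <-> linear_growth u l.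
Proof.
split=> [/cvgrPdist_le ul e e0|ul].
  have [N _ HN] := ul e e0.
  (* The finitely many indices up to [N] are absorbed by the constant. *)
  exists (\sum_(i < N.+1) `|u i - i%:R * l|) => n.
  have sum0 : 0 <= \sum_(i < N.+1) `|u i - i%:R * l| by exact: sumr_ge0.
  have [nN|Nn] := ltnP n N.+1.
    rewrite (bigD1 (Ordinal nN))//= addrCA lerDl.
    by rewrite addr_ge0 ?sumr_ge0 ?mulr_ge0 ?(ltW e0).
  have n0 : 0 < (n%:R : R) by rewrite ltr0n (leq_trans _ Nn).
  apply: (@le_trans _ _ (n%:R * e)); last by rewrite lerDl.
  have /= := HN n (ltnW Nn); rewrite distrC => h.
  move: h; rewrite -[in X in X -> _](ler_pM2l n0); apply: le_trans.
  rewrite -[X in X * `|_|](gtr0_norm n0) -normrM mulrBr mulrA divff ?mul1r//.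
  by rewrite gt_eqF.
apply/cvgrPdist_le => e e0.
have e20 : 0 < e / 2 by lra.
have [C HC] := ul (e / 2) e20.
exists (Num.truncn (2 * C / e)).+1 => // n /= Nn.
have n0 : 0 < (n%:R : R) by rewrite ltr0n (leq_trans _ Nn).
rewrite distrC -(ler_pM2l n0) -[X in X * `|_|](gtr0_norm n0) -normrM mulrBr.
rewrite mulrA divff ?gt_eqF// mul1r; apply: (le_trans (HC n)).
have : 2 * C / e <= n%:R.
  by apply/ltW/(lt_le_trans (truncnS_gt _)); rewrite ler_nat.
by rewrite ler_pdivrMr// => H; lra.
Qed.

Lemma cvge_fin_itvP (R : realType) (T : Type) (F : set_system T) (FF : Filter F)
    (f : T -> \bar R) (l : R) :
  (f x @[x --> F] --> l%:E) <->
  (forall a, a < l -> \forall x \near F, (a%:E < f x)%E) /\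
  (forall b, l < b -> \forall x \near F, (f x < b%:E)%E).
Proof.
split=> [fl|[fa fb]].
  split=> c lc.
    by apply: (fl [set y | (c%:E < y)%E]); apply: open_ereal_gt'; rewrite lte_fin.
  by apply: (fl [set y | (y < c%:E)%E]); apply: open_ereal_lt'; rewrite lte_fin.
apply/fine_cvgP; split.
  have lB : l - 1 < l by lra.
  have lD : l < l + 1 by lra.
  near=> x; rewrite fin_numElt; apply/andP; split.
    apply: (@lt_trans _ _ (l - 1)%:E); first exact: ltNyr.
    by near: x; exact: fa.
  apply: (@lt_trans _ _ (l + 1)%:E); last exact: ltry.
  by near: x; exact: fb.
apply/cvgrPdist_le => e e0.
have lB : l - e < l by lra.
have lD : l < l + e by lra.
near=> x.
have : ((l - e)%:E < f x)%E by near: x; exact: fa.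
have : (f x < (l + e)%:E)%E by near: x; exact: fb.
by rewrite /=; case: (f x) => [r| |]//=; rewrite !lte_fin ler_norml; lra.
Unshelve. all: by end_near. Qed.

Section inversion.
Context (Omega : Type) (R : realType) (U : nat -> Omega -> R * R) (w : Omega).

Lemma perturbed_walk_le_max k n : (1 <= k <= n)%N ->
  perturbed_walk U k w <= perturbed_walk_max U n w.
Proof.
move=> kn; rewrite /perturbed_walk_max.
by apply: (@le_bigmax_seq _ _ _ _ _ k); rewrite // mem_index_iota ltnS.
Qed.

Lemma perturbed_walk_max_le n c : (0 < n)%N ->
  (forall k, (1 <= k <= n)%N -> perturbed_walk U k w <= c) ->
  perturbed_walk_max U n w <= c.
Proof.
move=> n0 H; rewrite /perturbed_walk_max big_seq.
apply: bigmax_le => [|k]; first by apply: H; rewrite leqnn.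
by rewrite mem_index_iota ltnS => /H.
Qed.

Lemma first_passage_le n t : (0 < n)%N ->
  t < perturbed_walk_max U n w -> (first_passage U t w <= n%:R%:E)%E.
Proof.
move=> n0 tM; have [k kn tk] : exists2 k, (1 <= k <= n)%N & t < perturbed_walk U k w.
  apply: contrapT => noK; move: tM; apply/negP; rewrite -leNgt.
  apply: perturbed_walk_max_le => // k kn; rewrite leNgt; apply/negP => h.
  by apply: noK; exists k.
have /andP[k1 kn'] := kn.
apply: (@le_trans _ _ (k%:R : R)%:E); last by rewrite lee_fin ler_nat.
by apply: ereal_inf_lbound; exists k.
Qed.

Lemma first_passage_gt n t :
  perturbed_walk_max U n w <= t -> (n%:R%:E < first_passage U t w)%E.
Proof.
move=> Mt; apply: (@lt_le_trans _ _ (n.+1%:R : R)%:E).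
  by rewrite lte_fin ltr_nat.
apply: le_ereal_inf_tmp => _ [k [k1 tk] <-]; rewrite lee_fin ler_nat ltnNge.
apply/negP => kn; move: tk; apply/negP; rewrite -leNgt.
by apply: le_trans Mt; apply: perturbed_walk_le_max; rewrite k1.
Qed.

Lemma first_passage_cvgP (l : R) :
  ((t^-1)%:E * first_passage U t w)%E @[t --> +oo%R] --> l%:E <->
  (forall a, a < l -> \forall t \near +oo%R, ((t * a)%:E < first_passage U t w)%E) /\
  (forall b, l < b -> \forall t \near +oo%R, (first_passage U t w < (t * b)%:E)%E).
Proof.
have scale_lt (x : \bar R) (t a : R) : 0 < t ->
    ((a%:E < (t^-1)%:E * x) = ((t * a)%:E < x))%E.
  by move=> t0; rewrite lte_pdivlMl.
have scale_gt (x : \bar R) (t a : R) : 0 < t ->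
    (((t^-1)%:E * x < a%:E) = (x < (t * a)%:E))%E.
  by move=> t0; rewrite lte_pdivrMl.
split=> [/cvge_fin_itvP[Ha Hb]|[Ha Hb]].
  split=> c lc; [move: (Ha c lc)|move: (Hb c lc)] => Hc; near=> t.
    rewrite -scale_lt; last by near: t; apply: nbhs_pinfty_gt; exact: num_real.
    by near: t.
  rewrite -scale_gt; last by near: t; apply: nbhs_pinfty_gt; exact: num_real.
  by near: t.
apply/cvge_fin_itvP; split=> c lc; near=> t.
  rewrite scale_lt; last by near: t; apply: nbhs_pinfty_gt; exact: num_real.
  by near: t; exact: Ha.
rewrite scale_gt; last by near: t; apply: nbhs_pinfty_gt; exact: num_real.
by near: t; exact: Hb.
Unshelve. all: by end_near. Qed.

(** At the level [t = n (mu + e)] the passage time exceeds [n], hence the maximum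
    of the first [n] terms is at most [t]; at [t = n (mu - e)] the passage has
    occurred by time [n], hence the maximum exceeds [t]. *)
Lemma max_growth_of_passage (mu : R) : 0 < mu ->
  ((t^-1)%:E * first_passage U t w)%E @[t --> +oo%R] --> (mu^-1)%:E ->
  n%:R^-1 * perturbed_walk_max U n w @[n --> \oo] --> mu.
Proof.
move=> mu0 /first_passage_cvgP[Ha Hb].
apply/cvgrPdist_le => e0 e00.
(* The error is kept below [mu] so that [mu - e] has an inverse. *)
pose e := Num.min e0 (mu / 2).
have e_gt0 : 0 < e by rewrite lt_min e00; lra.
have e_lt : e < mu by rewrite gt_min; apply/orP; right; lra.
have e_le : e <= e0 by rewrite ge_min lexx.
have la : (mu + e)^-1 < mu^-1 by rewrite ltf_pV2 ?posrE//; lra.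
have lb : mu^-1 < (mu - e)^-1 by rewrite ltf_pV2 ?posrE//; lra.
have [t1 [_ H1]] := Ha _ la; have [t2 [_ H2]] := Hb _ lb.
pose t0 := Num.max t1 t2.
exists (Num.truncn (`|t0| / (mu - e))).+1 => // n /= Nn.
have n0 : (0 < n)%N by exact: leq_trans Nn.
have n0' : 0 < (n%:R : R) by rewrite ltr0n.
have : `|t0| / (mu - e) < n%:R.
  by apply: (lt_le_trans (truncnS_gt _)); rewrite ler_nat.
rewrite ltr_pdivrMr ?subr_gt0// => tn.
have tt : t0 < n%:R * (mu - e) by apply: le_lt_trans tn; exact: ler_norm.
have t1n : t1 < n%:R * (mu - e) by apply: le_lt_trans tt; rewrite le_max lexx.
have t2n : t2 < n%:R * (mu - e) by apply: le_lt_trans tt; rewrite le_max lexx orbT.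
have upper : perturbed_walk_max U n w <= n%:R * (mu + e).
  rewrite leNgt; apply/negP => /(first_passage_le n0); apply/negP; rewrite -ltNge.
  have := H1 (n%:R * (mu + e)); rewrite mulfK; last by rewrite gt_eqF//; lra.
  by apply; apply: (lt_trans t1n); rewrite ltr_pM2l//; lra.
have lower : n%:R * (mu - e) < perturbed_walk_max U n w.
  rewrite ltNge; apply/negP => /first_passage_gt; apply/negP; rewrite -leNgt.
  have := H2 (n%:R * (mu - e)) t2n; rewrite mulfK; last by rewrite gt_eqF//; lra.
  exact: ltW.
rewrite distrC -(ler_pM2l n0') -[X in X * `|_|](gtr0_norm n0') -normrM mulrBr.
rewrite mulrA divff ?gt_eqF// mul1r ler_norml.
have : n%:R * e <= n%:R * e0 by rewrite ler_pM2l.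
by move=> ?; apply/andP; split; lra.
Qed.

(** For a slope [a < 1 / mu] the maximum up to time [t a + 1] is still below [t]
    when [t] is large, because [a mu < 1]; for [b > 1 / mu] the maximum up to time
    [t b - 1] already exceeds [t]. *)
Lemma passage_growth_of_max (mu : R) : 0 < mu ->
  n%:R^-1 * perturbed_walk_max U n w @[n --> \oo] --> mu ->
  ((t^-1)%:E * first_passage U t w)%E @[t --> +oo%R] --> (mu^-1)%:E.
Proof.
move=> mu0 /cvg_linear_growth growth; apply/first_passage_cvgP; split.
  have main c : 0 < c -> c < mu^-1 ->
      \forall t \near +oo%R, ((t * c)%:E < first_passage U t w)%E.
    move=> c0 cmu.
    have cm1 : c * mu < 1 by rewrite -(@mulVf _ mu) ?gt_eqF// ltr_pM2r.
    (* Chosen so that [c (mu + e)] is the midpoint of [c mu] and 1. *)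
    pose e := (1 - c * mu) / (2 * c).
    have ce : c * e = (1 - c * mu) / 2 by rewrite /e; field; rewrite gt_eqF.
    have e0 : 0 < e by rewrite divr_gt0//; lra.
    have [C HC] := growth e e0.
    near=> t.
    have t0 : 0 < t by near: t; apply: nbhs_pinfty_gt; exact: num_real.
    have tc0 : 0 <= t * c by rewrite mulr_ge0// ltW.
    have /andP[n1 n2] := truncn_itv tc0.
    apply: (@lt_trans _ _ ((Num.truncn (t * c)).+1%:R)%:E).
      by rewrite lte_fin.
    apply: first_passage_gt; set n := (Num.truncn (t * c)).+1.
    have := HC n; rewrite ler_norml => /andP[_ h].
    have tbig : 2 * (mu + e + C) / (1 - c * mu) <= t.
      by near: t; apply: nbhs_pinfty_ge; exact: num_real.
    move: tbig; rewrite ler_pdivrMr ?subr_gt0// => tbig.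
    have nle : n%:R <= t * c + 1 by rewrite /n -natr1; lra.
    have : n%:R * (mu + e) <= (t * c + 1) * (mu + e) by rewrite ler_pM2r//; lra.
    have : t * (c * e) = t * ((1 - c * mu) / 2) by rewrite ce.
    by lra.
  move=> a amu; have mV0 : 0 < mu^-1 by rewrite invr_gt0.
  pose c := Num.max a (mu^-1 / 2).
  have c0 : 0 < c by rewrite lt_max; apply/orP; right; lra.
  have cm : c < mu^-1 by rewrite gt_max amu/=; lra.
  have Hc := main c c0 cm; near=> t.
  apply: (@le_lt_trans _ _ (t * c)%:E); last by near: t.
  rewrite lee_fin ler_pM2l; last by near: t; apply: nbhs_pinfty_gt; exact: num_real.
  by rewrite le_max lexx.
have main c : mu^-1 < c ->
    \forall t \near +oo%R, (first_passage U t w <= (t * c)%:E)%E.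
  move=> mc; have c0 : 0 < c by apply: lt_trans mc; rewrite invr_gt0.
  have cm1 : 1 < c * mu by rewrite -(@mulVf _ mu) ?gt_eqF// ltr_pM2r.
  (* Chosen so that [c (mu - e)] is the midpoint of 1 and [c mu]. *)
  pose e := (c * mu - 1) / (2 * c).
  have ce : c * e = (c * mu - 1) / 2 by rewrite /e; field; rewrite gt_eqF.
  have e0 : 0 < e by rewrite divr_gt0//; lra.
  have emu : 0 < mu - e by rewrite -(pmulr_rgt0 _ c0) mulrBr ce; lra.
  have [C HC] := growth e e0.
  near=> t.
  have t0 : 0 < t by near: t; apply: nbhs_pinfty_gt; exact: num_real.
  have tc1 : 1 < t * c.
    by rewrite -ltr_pdivrMr//; near: t; apply: nbhs_pinfty_gt; exact: num_real.
  have tc0 : 0 <= t * c by lra.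
  have /andP[] := truncn_itv tc0.
  set n := Num.truncn (t * c) => n1; rewrite -natr1 => n2.
  have n0 : (0 < n)%N by rewrite -(ltr_nat R); lra.
  apply: (@le_trans _ _ (n%:R)%:E); last by rewrite lee_fin.
  apply: first_passage_le => //.
  have := HC n; rewrite ler_norml => /andP[h _].
  have tbig : 2 * (mu - e + C) / (c * mu - 1) < t.
    by near: t; apply: nbhs_pinfty_gt; exact: num_real.
  move: tbig; rewrite ltr_pdivrMr ?subr_gt0// => tbig.
  have : (t * c - 1) * (mu - e) <= n%:R * (mu - e) by rewrite ler_pM2r//; lra.
  have : t * (c * e) = t * ((c * mu - 1) / 2) by rewrite ce.
  by lra.
move=> b mb; pose c := (mu^-1 + b) / 2.
have cb : c < b by rewrite /c; lra.
have mc : mu^-1 < c by rewrite /c; lra.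
have Hc := main c mc; near=> t.
apply: (@le_lt_trans _ _ (t * c)%:E); first by near: t.
by rewrite lte_fin ltr_pM2l.
Unshelve. all: by end_near. Qed.

End inversion.

(** * Growth of the maximum along a trajectory *)

(** Without an index satisfying [g] in [[a n, n)] the counts at [a n] and at [n]
    would agree, whereas they differ by about [(1 - a) p n]. *)
Lemma frequent_index (R : realType) (g : nat -> bool) (p : R) : 0 < p ->
  linear_growth (fun n => \sum_(i < n) ((g i)%:R : R)) p ->
  forall a : R, 0 <= a -> a < 1 -> exists n0 : R, forall n, n0 < n%:R ->
    exists i, [/\ (i < n)%N, a * n%:R - 1 <= i%:R & g i].
Proof.
move=> p0 growth a a0 a1.
pose e := (1 - a) * p / 4.
have e0 : 0 < e by rewrite /e divr_gt0// mulr_gt0//; lra.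
have [C HC] := growth e e0.
exists (C / e) => n; rewrite ltr_pdivrMr// => nC.
have an0 : 0 <= a * n%:R by rewrite mulr_ge0.
have /andP[j1] := truncn_itv an0.
set j := Num.truncn (a * n%:R) in j1 *; rewrite -natr1 => j2.
have jn : (j <= n)%N by rewrite -(ler_nat R); apply: le_trans j1 _; rewrite ler_piMl// ltW.
apply: contrapT => none.
have eqsum : \sum_(i < n) ((g i)%:R : R) = \sum_(i < j) (g i)%:R.
  rewrite -!(big_mkord xpredT (fun i => (g i)%:R)) (big_cat_nat (leq0n j) jn)//=.
  rewrite [X in _ + X]big_nat_cond [X in _ + X]big1 ?addr0// => i /andP[/andP[ji ni] _].
  case: (boolP (g i)) => // gi; exfalso; apply: none; exists i; split => //.
  by have : (j%:R : R) <= i%:R; [rewrite ler_nat|lra].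
have := HC n; have := HC j; rewrite eqsum !ler_norml.
move=> /andP[_ h1] /andP[h2 _].
have h3 : j%:R * p <= a * n%:R * p by rewrite ler_pM2r.
have h4 : j%:R * e <= n%:R * e by rewrite ler_pM2r// ler_nat.
have h5 : n%:R * e * 4 = n%:R * p - a * n%:R * p by rewrite /e; field.
lra.
Qed.

Section growth_of_max.
Context (Omega : Type) (R : realType) (U : nat -> Omega -> R * R) (w : Omega).
Context (mu : R).
Hypothesis mu0 : 0 < mu.
Hypothesis growth_xi : linear_growth (fun n => \sum_(i < n) (U i w).1) mu.

Let walkS k : perturbed_walk U k.+1 w = \sum_(i < k) (U i w).1 + (U k w).2.
Proof. by []. Qed.

(** The positive part of a perturbation is the increment of a sequence which
    grows linearly, hence it is negligible with respect to the index. *)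
Lemma perturbed_walk_max_upper b :
  linear_growth (fun n => \sum_(i < n) Num.max (U i w).2 0) b ->
  forall e : R, 0 < e -> exists C : R, forall n, (0 < n)%N ->
    perturbed_walk_max U n w <= n%:R * (mu + e) + C.
Proof.
have mu_gt0 := mu0; move=> growth_eta e e0; have e3 : 0 < e / 3 by lra.
have [C1 H1] := growth_xi e3; have [C2 H2] := growth_eta _ e3.
exists (b + e / 3 + 2 * C2 + C1) => n n0; apply: perturbed_walk_max_le => //.
move=> [//|k] /= kn; rewrite walkS.
have := H1 k; have := H2 k; have := H2 k.+1; rewrite !ler_norml.
rewrite big_ord_recr/= -natr1 => /andP[_ h1] /andP[h2 _] /andP[_ h3].
have h4 : (U k w).2 <= Num.max (U k w).2 0 by rewrite le_max lexx.
have h5 : k%:R * (mu + e) <= n%:R * (mu + e).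
  by apply: ler_wpM2r; [lra|rewrite ler_nat ltnW].
lra.
Qed.

(** Very negative perturbations may spoil most terms, but perturbations above [K]
    occur with frequency [p]; so one of them occurs at an index close to [n], and
    the corresponding term is close to [n mu]. *)
Lemma perturbed_walk_max_lower K p : 0 < p ->
  linear_growth (fun n => \sum_(i < n) ((K < (U i w).2)%R%:R : R)) p ->
  forall e : R, 0 < e -> exists C : R, forall n, (0 < n)%N ->
    n%:R * (mu - e) - C <= perturbed_walk_max U n w.
Proof.
have mu_gt0 := mu0; move=> p0 growth_N e' e'0; pose e := Num.min e' mu.
have e0 : 0 < e by rewrite lt_min e'0.
have emu : e <= mu by rewrite ge_min lexx orbT.
have ee' : e <= e' by rewrite ge_min lexx.
have e2 : 0 < e / 2 by lra.
have [C1 H1] := growth_xi e2.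
(* The proportion of the time that may be lost: it costs [e / 2] of the slope. *)
pose a := 1 - e / 2 / mu.
have amu : a * mu = mu - e / 2 by rewrite /a; field; rewrite gt_eqF.
have a0 : 0 <= a by rewrite -(pmulr_lge0 _ mu0) amu; lra.
have a1 : a < 1 by rewrite /a ltrBlDr ltrDl divr_gt0.
have [n0 Hn0] := @frequent_index _ (fun i => K < (U i w).2) _ p0 growth_N _ a0 a1.
pose T1 := perturbed_walk U 1 w.
exists (`|C1| + `|K| + mu + `|n0| * mu + `|T1|) => n n_gt0.
have := ler_norm C1; have := ler_norm (- K); have := ler_norm (- T1).
rewrite !normrN => hT hK hC.
have n0mu : 0 <= `|n0| * mu by rewrite mulr_ge0// ltW.
have [nK T1n] := (normr_ge0 K, normr_ge0 T1); have nC1 := normr_ge0 C1.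
have nee' : n%:R * (mu - e') <= n%:R * (mu - e) by rewrite ler_wpM2l//; lra.
(* For the first few [n] the first term of the maximum is enough. *)
have [nn0|n0n] := lerP n%:R n0.
  have : T1 <= perturbed_walk_max U n w by apply: perturbed_walk_le_max; rewrite n_gt0.
  have : n%:R * (mu - e) <= `|n0| * mu.
    apply: ler_pM => //; [lra| |lra]; exact: le_trans nn0 (ler_norm _).
  lra.
have [i [in_ ai gi]] := Hn0 n n0n.
have : perturbed_walk U i.+1 w <= perturbed_walk_max U n w.
  exact: perturbed_walk_le_max.
have := H1 i; rewrite walkS ler_norml => /andP[h _].
have : (a * n%:R - 1) * (mu - e / 2) <= i%:R * (mu - e / 2).
  by rewrite ler_pM2r//; lra.
have : n%:R * (a * mu) = n%:R * (mu - e / 2) by rewrite amu.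
have : a * (n%:R * (e / 2)) <= n%:R * (e / 2).
  by rewrite ler_piMl ?mulr_ge0// ltW.
lra.
Qed.

Lemma perturbed_walk_max_growth b K p : 0 < p ->
  linear_growth (fun n => \sum_(i < n) Num.max (U i w).2 0) b ->
  linear_growth (fun n => \sum_(i < n) ((K < (U i w).2)%R%:R : R)) p ->
  linear_growth (fun n => perturbed_walk_max U n w) mu.
Proof.
move=> p0 gb gp e e0.
have [C HC] := perturbed_walk_max_upper gb e0.
have [C' HC'] := perturbed_walk_max_lower p0 gp e0.
exists (`|C| + `|C'| + `|perturbed_walk_max U 0 w|) => -[|n].
  by rewrite !mul0r subr0 add0r lerDr addr_ge0.
have := HC _ (ltn0Sn n); have := HC' _ (ltn0Sn n).
have := ler_norm C; have := ler_norm C'; have := normr_ge0 C.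
have := normr_ge0 C'; have := normr_ge0 (perturbed_walk_max U 0 w).
by rewrite ler_norml => *; apply/andP; split; lra.
Qed.

(** A perturbation is at most the current maximum minus the current walk, and
    these two have the same slope. *)
Lemma perturbation_eventually_le :
  linear_growth (fun n => perturbed_walk_max U n w) mu ->
  exists m, forall i, (m <= i)%N -> (U i w).2 <= i%:R.
Proof.
move=> growth_M; have e0 : 0 < (4^-1 : R) by lra.
have [C HC] := growth_xi e0; have [C' HC'] := growth_M _ e0.
exists (Num.truncn (2 * (mu + 1 + C + C'))).+1 => i mi.
have : 2 * (mu + 1 + C + C') < i%:R.
  by apply: lt_le_trans (truncnS_gt _) _; rewrite ler_nat.
have := HC i; have := HC' i.+1; rewrite !ler_norml -natr1.
move=> /andP[_ h1] /andP[h2 _].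
have : perturbed_walk U i.+1 w <= perturbed_walk_max U i.+1 w.
  by apply: perturbed_walk_le_max; rewrite leqnn.
rewrite walkS; lra.
Qed.

End growth_of_max.

(** * Integrability of the perturbation *)

Section second_borel_cantelli.
Context d d' (Omega : measurableType d) (T : measurableType d') (R : realType).
Context (P : probability Omega R) (V : nat -> {RV P >-> T}).
Hypothesis Vind : mutually_independent V.

Lemma cylinder_prob_le_expR n (A : nat -> set T) (q : nat -> R) :
  (forall i, measurable (A i)) ->
  (forall i, (P (V i @^-1` A i) <= (1 - q i)%:E)%E) ->
  (P (cylinder V n A) <= (expR (- \sum_(i < n) q i))%:E)%E.
Proof.
move=> mA Aq; rewrite cylinder_prob//; elim: n => [|n IH].
  by rewrite !big_ord0 oppr0 expR0.
rewrite !big_ord_recr/= opprD expRD EFinM; apply: lee_pmul => //.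
  exact: prode_ge0.
by apply: (le_trans (Aq n)); rewrite lee_fin expR_ge1Dx.
Qed.

(** The second Borel-Cantelli lemma, in contraposed form. Some tail event
    (no [A i] occurs from [m] on) has a probability [c > 0]; by independence [c] is
    at most the product of the [1 - P (A i)], hence at most the exponential of
    minus any partial sum over the indices [i >= m]. *)
Lemma summable_of_eventually_avoid (A : nat -> set T) :
  (forall i, measurable (A i)) ->
  {ae P, forall w, exists m, forall i, (m <= i)%N -> ~ A i (V i w)} ->
  (\sum_(i <oo) P (V i @^-1` A i) < +oo)%E.
Proof.
move=> mA avoid.
have mVA i : measurable (V i @^-1` A i).
  by rewrite -[X in measurable X]setTI; exact: measurable_funPT.
pose B m : set Omega := \bigcap_(i in [set i | (m <= i)%N]) ~` (V i @^-1` A i).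
have mB m : measurable (B m).
  by apply: bigcap_measurable => [|i _]; [exists m => /=|exact: measurableC].
have [m Bm] : exists m, P (B m) != 0%E.
  apply: contrapT => noB.
  have [N [mN PN0 NB]] := avoid.
  have UB0 : P.-negligible (\bigcup_m B m).
    apply: negligible_bigcup => m; apply/negligibleP => //.
    by apply/eqP; apply: contrapT => /negP Bm; apply: noB; exists m.
  have NN : P.-negligible N by exact/negligibleP.
  have /negligibleP : P.-negligible [set: Omega].
    apply: negligibleS (negligibleU UB0 NN) => w _.
    have [Nw|nNw] := pselect (N w); [by right|left].
    have [m Hm] : exists m, forall i, (m <= i)%N -> ~ A i (V i w).
      by apply: contrapT => h; apply: nNw; exact: NB.
    by exists m => // i /= mi; exact: Hm.
  move=> /(_ measurableT) /= P0; have := probability_setT P; rewrite P0.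
  by move=> /eqP; rewrite eq_sym onee_eq0.
pose c := fine (P (B m)).
have PBc : P (B m) = c%:E by rewrite /c fineK// fin_num_measure.
have c0 : 0 < c.
  by rewrite -lte_fin -PBc lt_neqAle eq_sym Bm measure_ge0.
pose p i := fine (P (V i @^-1` A i)).
have pE i : P (V i @^-1` A i) = (p i)%:E by rewrite /p fineK// fin_num_measure.
have p0 i : 0 <= p i by apply: fine_ge0.
have p1 i : p i <= 1 by rewrite -lee_fin -pE probability_le1.
(* Indices below [m] are left free, at the price of [m] in the final bound. *)
pose A' i := if (i < m)%N then setT else ~` A i.
pose q i := if (i < m)%N then 0 else p i.
have mA' i : measurable (A' i).
  by rewrite /A'; case: ifP => _ //; exact: measurableC.
have A'q i : (P (V i @^-1` A' i) <= (1 - q i)%:E)%E.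
  rewrite /A' /q; case: ifP => _; first by rewrite subr0 preimage_setT probability_le1.
  by rewrite preimage_setC (probability_setC P (mVA i)) pE -EFinB.
have qbound n : \sum_(i < n) q i <= - ln c.
  have BC : B m `<=` cylinder V n A'.
    move=> w Bw i /= _; rewrite /A' /=; case: ifPn => // im.
    by apply: Bw => /=; rewrite leqNgt.
  have : (c%:E <= (expR (- \sum_(i < n) q i))%:E)%E.
    rewrite -PBc; apply: le_trans (cylinder_prob_le_expR n mA' A'q).
    by apply: le_measure => //; rewrite inE//; exact: measurable_cylinder.
  by rewrite lee_fin -[X in X <= _](lnK c0) ler_expR lerNr.
have pq i : p i <= q i + (i < m)%:R.
  by rewrite /q; case: ifP => _; rewrite ?add0r ?addr0.
apply: (@le_lt_trans _ _ (- ln c + m%:R)%:E); last exact: ltry.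
apply: lime_le; first exact: is_cvg_nneseries.
apply: nearW => n.
under eq_bigr do rewrite pE.
rewrite sumEFin lee_fin big_mkord.
apply: (@le_trans _ _ (\sum_(i < n) (q i + (i < m)%:R))).
  by apply: ler_sum => i _; exact: pq.
rewrite big_split/= lerD ?qbound//.
have -> : \sum_(i < n) ((i < m)%:R : R) = (minn n m)%:R.
  elim: n => [|n IH]; first by rewrite big_ord0 min0n.
  rewrite big_ord_recr/= IH -natrD; congr (_%:R).
  by case: ltnP => nm /=; lia.
by rewrite ler_nat geq_minr.
Qed.


End second_borel_cantelli.

(** A real is at most the number of naturals strictly below it. *)
Lemma maxr0_le_nneseries (R : realType) (x : R) :
  ((Num.max x 0)%:E <= \sum_(i <oo) ((i%:R < x)%R%:R : R)%:E)%E.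
Proof.
pose N := (Num.truncn x).+1.
have xN : x <= N%:R by apply/ltW/truncnS_gt.
apply: (@le_trans _ _ (\sum_(0 <= i < N) ((i%:R < x)%R%:R : R)%:E)%E); last first.
  by apply: nneseries_lim_ge => i _ _; rewrite lee_fin.
rewrite sumEFin lee_fin; elim: N xN => [|n IH] xN.
  by rewrite big_nil ge_max xN lexx.
rewrite big_nat_recr//=; have [nx|xn] := ltrP n%:R x; last first.
  by rewrite addr0 IH.
rewrite (eq_big_nat _ _ (F2 := fun=> 1)).
  by rewrite sumr_const_nat subn0 natr1 ge_max xN ler0n.
by move=> i /andP[_ ni]; rewrite (le_lt_trans _ nx)// ler_nat ltnW.
Qed.

Lemma expectation_pos_lty d (Omega : measurableType d) (R : realType)
    (P : probability Omega R) (X : Omega -> R) : measurable_fun setT X ->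
  (\sum_(i <oo) P [set w | (i%:R < X w)%R] < +oo)%E ->
  (\int[P]_w (Num.max (X w) 0)%:E < +oo)%E.
Proof.
move=> mX; apply: le_lt_trans.
have mlt (i : nat) : measurable [set w | i%:R < X w].
  have := mX measurableT `]i%:R, +oo[%classic (measurable_itv _).
  by rewrite setTI preimage_itvoy.
have indE (i : nat) w : ((i%:R < X w)%R%:R : R) = \1_[set w | i%:R < X w] w.
  by rewrite indicE mem_setE.
apply: (@le_trans _ _ (\int[P]_w (\sum_(i <oo) ((i%:R < X w)%R%:R : R)%:E))%E).
  apply: ge0_le_integral => //.
  - by move=> w _; rewrite lee_fin le_max lexx orbT.
  - by apply/measurable_EFinP; exact: measurable_maxr.
  - apply: (ge0_emeasurable_sum (P := xpredT)) => [i w _ _|i _]; first by rewrite lee_fin.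
    by apply/measurable_EFinP; under eq_fun do rewrite indE; exact: measurable_indic.
  - by move=> w _; exact: maxr0_le_nneseries.
rewrite integral_nneseries//.
  apply: lee_nneseries => [i _ _|i _].
    by apply: integral_ge0 => w _; rewrite lee_fin.
  by under eq_integral do rewrite indE; rewrite integral_indic// setIT.
by move=> i; apply/measurable_EFinP; under eq_fun do rewrite indE; exact: measurable_indic.
Qed.

(** The difference of two nonnegative extended reals is finite only if both are:
    a finite mean is the mean of an integrable function. *)
Lemma integrable_of_fin_integral d (Omega : measurableType d) (R : realType)
    (P : {measure set Omega -> \bar R}) (f : Omega -> \bar R) :
  measurable_fun setT f -> (\int[P]_w f w \is a fin_num)%E ->
  P.-integrable setT f.
Proof.
move=> mf; rewrite integralE => fin; apply/integrableP; split => //.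
have := fune_abse f; rewrite /comp => ->.
rewrite ge0_integralD//; last 2 first.
- exact: measurable_funepos.
- exact: measurable_funeneg.
move: fin; have : (0 <= \int[P]_x f^\+ x)%E by exact: integral_ge0.
have : (0 <= \int[P]_x f^\- x)%E by exact: integral_ge0.
case: (\int[P]_x f^\+ x)%E => [a| |]; case: (\int[P]_x f^\- x)%E => [b| |] //=.
by move=> _ _ _; rewrite -EFinD ltry.
Qed.

(** * The equivalence *)

Theorem theorem2p2 (d : measure_display) (Omega : measurableType d)
    (R : realType) (P : probability Omega R)
    (xi_eta : {RV P >-> (measurableTypeR R * measurableTypeR R)%type})
    (V : nat -> {RV P >-> (measurableTypeR R * measurableTypeR R)%type})
    (V_copies : independent_copies V xi_eta)
    (mu : R) (mu_gt0 : 0 < mu)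
    (xi_mean : ('E_P[fun w => (xi_eta w).1] = mu%:E)%E) :
  [<-> (* (S1) *)
       {ae P, forall w,
          ((t^-1)%:E * first_passage (fun n => V n) t w)%E @[t --> +oo%R]
            --> (mu^-1)%:E};
       (* (S2) *)
       {ae P, forall w,
          (n%:R^-1 * perturbed_walk_max (fun n => V n) n w) @[n --> \oo]
            --> mu};
       (* (S3) *)
       ('E_P[fun w => Num.max (xi_eta w).2 0%R] < +oo)%E ].
Proof.
set T := (measurableTypeR R * measurableTypeR R)%type in xi_eta V V_copies xi_mean *.
have mfst : measurable_fun [set: T] (fun z : T => z.1 : R) by exact: measurable_fst.
have msnd : measurable_fun [set: T] (fun z : T => z.2 : R) by exact: measurable_snd.
have mY : measurable_fun setT xi_eta by exact: measurable_funPT.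
have EE (X : Omega -> R) : ('E_P[X] = \int[P]_w (X w)%:E)%E by rewrite unlock.
rewrite EE in xi_mean; rewrite EE.
have ixi : P.-integrable setT (fun w => ((xi_eta w).1 : R)%:E).
  apply: integrable_of_fin_integral; last by rewrite xi_mean.
  by apply/measurable_EFinP; exact: (measurableT_comp mfst mY).
have growth_xi := strong_law V_copies mfst ixi xi_mean.
tfae.
- by apply: filterS => w; exact: max_growth_of_passage.
- move=> growth_M.
  apply: (expectation_pos_lty (X := fun w => (xi_eta w).2)).
    exact: (measurableT_comp msnd mY).
  pose A (i : nat) : set T := [set z | i%:R < z.2].
  have mA i : measurable (A i).
    have := msnd measurableT `]i%:R, +oo[%classic (measurable_itv _).
    by rewrite setTI preimage_itvoy.
  have -> : (\sum_(i <oo) P [set w | (i%:R < (xi_eta w).2)%R] =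
             \sum_(i <oo) P (V i @^-1` A i))%E.
    by apply: eq_eseriesr => i _; apply/esym; exact: V_copies.2.
  apply: summable_of_eventually_avoid => //; first exact: V_copies.1.
  apply: filterS2 growth_xi growth_M => w gxi /cvg_linear_growth gM.
  have [m Hm] := perturbation_eventually_le gxi gM.
  by exists m => i /Hm; rewrite leNgt => /negP.
- move=> eta_lty.
  have meta : measurable_fun [set: T] (fun z : T => Num.max (z.2 : R) 0).
    exact: measurable_maxr.
  have ieta : P.-integrable setT (fun w => (Num.max ((xi_eta w).2 : R) 0)%:E).
    apply/integrableP; split.
      by apply/measurable_EFinP; exact: (measurableT_comp meta mY).
    under eq_integral do rewrite gee0_abs ?lee_fin ?le_max ?lexx ?orbT//.
    exact: eta_lty.
  have [b bE] : exists b : R, (\int[P]_w (Num.max (xi_eta w).2 0)%:E = b%:E)%E.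
    by exists (fine (\int[P]_w (Num.max (xi_eta w).2 0)%:E)%E);
      rewrite fineK//; exact: integrable_fin_num ieta.
  have growth_eta := strong_law V_copies meta ieta bE.
  pose A (k : nat) : set T := [set z | - k%:R < z.2].
  have mA k : measurable (A k).
    have := msnd measurableT `]- k%:R, +oo[%classic (measurable_itv _).
    by rewrite setTI preimage_itvoy.
  have mYA k : measurable (xi_eta @^-1` A k).
    by rewrite -[X in measurable X]setTI; exact: mY.
  (* The perturbation is finite, so it exceeds some [- k] with positive probability. *)
  have [k Ak] : exists k, P (xi_eta @^-1` A k) != 0%E.
    apply: contrapT => noA.
    have : P.-negligible (\bigcup_k (xi_eta @^-1` A k)).
      apply: negligible_bigcup => k; apply/negligibleP => //.
      by apply/eqP; apply: contrapT => /negP h; apply: noA; exists k.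
    have -> : \bigcup_k (xi_eta @^-1` A k) = [set: Omega].
      apply/seteqP; split => // w _; exists (Num.truncn (- (xi_eta w).2)).+1 => //=.
      by rewrite /A/= ltrNl; exact: truncnS_gt.
    move=> /(negligibleP P measurableT) /= P0; have := probability_setT P.
    by rewrite P0 => /eqP; rewrite eq_sym onee_eq0.
  pose g (z : T) : R := ((- k%:R < z.2)%R)%:R.
  have gE : g = \1_(A k) by apply/funext => z; rewrite /g indicE mem_setE.
  have mg : measurable_fun setT g by rewrite gE; exact: measurable_indic.
  have gYE w : g (xi_eta w) = \1_(xi_eta @^-1` A k) w by rewrite gE.
  pose p := fine (P (xi_eta @^-1` A k)).
  have pE : P (xi_eta @^-1` A k) = p%:E by rewrite /p fineK// fin_num_measure.
  have p_gt0 : 0 < p by rewrite -lte_fin -pE lt_neqAle eq_sym Ak measure_ge0.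
  have gp : (\int[P]_w (g (xi_eta w))%:E = p%:E)%E.
    by under eq_integral do rewrite gYE; rewrite integral_indic// setIT.
  have ig : P.-integrable setT (fun w => (g (xi_eta w))%:E).
    apply: integrable_of_fin_integral; last by rewrite gp.
    by apply/measurable_EFinP; exact: (measurableT_comp mg mY).
  have growth_g := strong_law V_copies mg ig gp.
  apply: filterS3 growth_xi growth_eta growth_g => w gxi geta gg.
  apply: passage_growth_of_max => //; apply/cvg_linear_growth.
  exact: (perturbed_walk_max_growth (K := - k%:R) mu_gt0 gxi p_gt0 geta gg).
Qed.
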